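(* Let $P_k$ be a category of $n_k$ tags and $1\le c_k\le n_k$. After round $\mathbb I_k$ of OPT-C1 followed by round $\mathbb Q_k$ of OPT-C2, exactly $c_k$ tags of $P_k$ are in the ready state, and each of them is assigned a unique reporting order (the value of its counter $cnt$) ranging from $1$ to $c_k$. Moreover, the set $T_k^{\mathbf r}$ of tags in the ready state has the same probability $1/\binom{n_k}{c_k}$ of being any $c_k$-subset of $P_k$.
   Context: Hashing is modelled as ideal: for a random seed $r$ and modulus $m$, the values $H(t,r)\bmod m$ over distinct tags $t$ are independent and uniform on $\{0,\dots,m-1\}$, and different seeds give independent hash functions. Round $\mathbb I_k$ (OPT-C1): for a seed $r$, tag $t\in P_k$ is selected iff $(H(t,r)\bmod n_k)\le c_k+3\sqrt{c_k}$. The reader tests independent random seeds until one is found for which the number of selected tags lies in $[c_k,c_k+6\sqrt{c_k}]$, and uses that seed; $P_k^{\mathbf s}$ is initially the resulting set of tags in the selected state. The reader knows all tag IDs, and hence knows $P_k^{\mathbf s}$. Round $\mathbb Q_k$ (OPT-C2): initially $T_k^{\mathbf r}=\emptyset$ and every tag of $P_k^{\mathbf s}$ has a counter $cnt=0$. Repeat the following iteration until $|T_k^{\mathbf r}|=c_k$: (1) the reader broadcasts a fresh random seed $r$ and $m=|P_k^{\mathbf s}|$; (2) each $t\in P_k^{\mathbf s}$ computes $h(t)=H(t,r)\bmod m$; (3) the reader broadcasts a bit vector $\mathbf F[0..m-1]$, where, successively for $i=0,\dots,m-1$, $\mathbf F[i]=1$ if $|T_k^{\mathbf r}|+\sum_{j=0}^{i-1}\mathbf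 F[j]<c_k$ and exactly one tag $t\in P_k^{\mathbf s}$ has $h(t)=i$, and $\mathbf F[i]=0$ otherwise; (4) each $t\in P_k^{\mathbf s}$ with $\mathbf F[h(t)]=1$ sets $cnt:=cnt+\sum_{i=0}^{h(t)}\mathbf F[i]$ and enters the ready state; every other $t\in P_k^{\mathbf s}$ sets $cnt:=cnt+\sum_{i=0}^{m-1}\mathbf F[i]$ and stays in the selected state; (5) the tags that entered the ready state are moved from $P_k^{\mathbf s}$ to $T_k^{\mathbf r}$. When $|T_k^{\mathbf r}|=c_k$ the round stops and all tags still in the selected state become unselected. *)

(* Defs.v *)
From HB Require Import structures.
From mathcomp Require Import all_boot all_order all_algebra.

Set Implicit Arguments.
Unset Strict Implicit.
Unset Printing Implicit Defensive.

Import Order.TTheory GRing.Theory Num.Theory.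

Local Open Scope nat_scope.

Section Protocol.
Variables (R : rcfType) (T : finType) (c : nat).
(* T is the category P_k, so n_k = #|T|.  The argument [h : T -> nat] of the
   functions below is the hash function H(., r) of the seed r in use. *)

Local Notation n := #|T|.

Definition selection (h : T -> nat) : {set T} :=
  [set t | ((h t %% n)%:R <= c%:R + 3%:R * Num.sqrt c%:R :> R)%R].

Definition good_selection (S : {set T}) : bool :=
  (c <= #|S|) && (#|S|%:R <= c%:R + 6%:R * Num.sqrt c%:R :> R)%R.

(* Tags outside [selected] and [ready] are in the unselected state. *)
Record tags := Tags {
  selected : {set T};
  ready : {set T};
  cnt : {ffun T -> nat}
}.

(* The first i bits F[0..i-1] of the bit vector F, for slots given by h. *)
Fixpoint bitvec (q : tags) (h : T -> nat) (i : nat) : seq bool :=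
  if i is j.+1 then
    let F := bitvec q h j in
    rcons F ((#|ready q| + \sum_(l < j) nth false F l < c)
             && (#|[set t in selected q | h t == j]| == 1))
  else [::].

Definition iteration (h : T -> nat) (q : tags) : tags :=
  let m := #|selected q| in
  let slot t := h t %% m in
  let F := bitvec q slot m in
  let moved := [set t in selected q | nth false F (slot t)] in
  Tags (selected q :\: moved) (ready q :|: moved)
    [ffun t =>
       if t \in moved then cnt q t + \sum_(i < (slot t).+1) nth false F i
       else if t \in selected q then cnt q t + \sum_(i < m) nth false F i
       else cnt q t].

(* [Testing]: round I is still looking for a seed; [Querying q]: round Q is
   running; [Stopped q]: round Q has stopped.  Each step before the stop
   consumes one seed. *)
Inductive state := Testing | Querying of tags | Stopped of tags.

(* When |T_k^r| = c, the tags still selected become unselected. *)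
Definition check_stop (q : tags) : state :=
  if #|ready q| == c then Stopped (Tags set0 (ready q) (cnt q))
  else Querying q.

Definition step (h : T -> nat) (st : state) : state :=
  match st with
  | Testing =>
      if good_selection (selection h)
      then check_stop (Tags (selection h) set0 [ffun=> 0])
      else Testing
  | Querying q => check_stop (iteration h q)
  | Stopped q => Stopped q
  end.

(* [h s] is the hash function of the s-th random seed drawn by the reader. *)
Fixpoint run (h : nat -> T -> nat) (N : nat) : state :=
  if N is N'.+1 then step (h N') (run h N') else Testing.

Definition outcome (h : nat -> T -> nat) (q : tags) : Prop :=
  exists N, run h N = Stopped q.

End Protocol.

From mathcomp Require Import all_classical all_reals all_analysis.

Local Open Scope classical_set_scope.
Local Open Scope ring_scope.

(* Mutual independence of random elements with values in a countable (discrete)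
   type, for which every subset of values is an event. *)
Definition mutually_independent (R : realType) (d : measure_display)
    (Omega : measurableType d) (P : probability Omega R)
    (I : eqType) (V : countType) (X : I -> Omega -> V) : Prop :=
  forall (J : seq I) (B : I -> set V), uniq J ->
    P [set w | forall i, i \in J -> B i (X i w)]
    = (\prod_(i <- J) P [set w | B i (X i w)])%E.

(* Ideal hashing; [H s t] is H(t, r_s) for the s-th random seed r_s.  A
   nat-valued variable cannot be uniform modulo every m, so uniformity is
   required for the moduli 1, ..., #|T| only; the protocol uses no others. *)
Definition ideal_hash (R : realType) (d : measure_display)
    (Omega : measurableType d) (P : probability Omega R) (T : finType)
    (H : nat -> T -> {RV P >-> nat}) : Prop :=
  [/\ forall (s m : nat) (t : T) (v : nat), (0 < m <= #|T|)%N -> (v < m)%N ->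
        P [set w | (H s t w %% m)%N = v] = (m%:R^-1)%:E,
      forall s m : nat, (0 < m <= #|T|)%N ->
        mutually_independent P (fun t w => (H s t w %% m)%N)
    & mutually_independent P (fun s w => [ffun t => H s t w])].

(* Main.v *)
(* Forgetting the counters turns the protocol into a Markov chain on a finite
   set of states: a step depends on its fresh seed only through the residues of
   the hash values modulo a number determined by the current state, and these
   residues are uniform over all functions from the tags to the slots.

   Counting the tags moved by a bit vector F shows that every reachable state
   keeps cnt a bijection from the ready tags onto 1, ..., |ready|, with the
   common value |ready| on the selected tags.

   From each reachable running state, some pattern of residues (a selection of
   acceptable size, resp. a collision-free assignment of slots) makes progress,
   so the chain stops almost surely.  A permutation of the tags permutes the
   residue patterns, hence preserves the transition probabilities; the stopping
   probability at each time is thus shared equally by the c-subsets. *)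
Require Import Defs.
From mathcomp Require Import all_boot all_order all_algebra.
From mathcomp Require Import perm zify lra.

Set Implicit Arguments.
Unset Strict Implicit.
Unset Printing Implicit Defensive.

Import Order.TTheory GRing.Theory Num.Theory.

Local Open Scope nat_scope.

(** * Counting the ones of the bit vector *)

Section BitVector.
Variables (T : finType) (c : nat) (q : tags T) (h : T -> nat).

Local Notation F m j := (nth false (bitvec c q h m) j).

Lemma size_bitvec m : size (bitvec c q h m) = m.
Proof. by elim: m => //= m IHm; rewrite size_rcons IHm. Qed.

Lemma nth_bitvecS m j : j < m -> F m.+1 j = F m j.
Proof. by move=> jm; rewrite /= nth_rcons size_bitvec jm. Qed.

(** Appending a bit leaves the earlier ones alone, so the rule for the newest bit can be read at
    every position of the full vector. *)
Lemma nth_bitvec m j : j < m ->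
  F m j = (#|ready q| + \sum_(l < j) F m l < c)
          && (#|[set t in selected q | h t == j]| == 1).
Proof.
elim: m => // m IHm; rewrite ltnS => jm.
under eq_bigr => l _ do rewrite nth_bitvecS ?(leq_trans (ltn_ord l))//.
move: jm; rewrite leq_eqVlt => /predU1P[->|jm]; last by rewrite nth_bitvecS ?IHm.
by rewrite /= nth_rcons size_bitvec ltnn eqxx.
Qed.

Definition prefix_count m j := \sum_(l < j) F m l.

Lemma prefix_countS m j : prefix_count m j.+1 = prefix_count m j + F m j.
Proof. by rewrite /prefix_count big_ord_recr. Qed.

Lemma prefix_count_mono m : {homo prefix_count m : i j / i <= j}.
Proof.
move=> i j /subnKC <-; elim: (j - i) => [|k IHk]; first by rewrite addn0.
by rewrite addnS prefix_countS (leq_trans IHk) ?leq_addr.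
Qed.

(** A bit is set only while the running total is below [c], so the total can reach [c] but not pass
    it. *)
Lemma prefix_count_le m j : #|ready q| <= c -> j <= m ->
  #|ready q| + prefix_count m j <= c.
Proof.
move=> rc; elim: j => [|j IHj] jm; first by rewrite /prefix_count big_ord0 addn0.
rewrite prefix_countS.
have := nth_bitvec jm; rewrite -/(prefix_count m j).
case: (nth _ _ _) => [/esym/andP[]|_]; first by lia.
by rewrite addn0; apply: IHj; lia.
Qed.

Lemma nth_bitvec_inj m t t' : h t < m -> t \in selected q -> t' \in selected q ->
  F m (h t) -> h t = h t' -> t = t'.
Proof.
move=> tm ts t's; rewrite nth_bitvec// => /andP[_ /cards1P[u us]] tt'.
have: t \in [set u] by rewrite -us inE ts /=.
have: t' \in [set u] by rewrite -us inE t's tt' /=.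
by rewrite !inE => /eqP -> /eqP ->.
Qed.

(** Double counting of pairs of a selected tag and its slot: a slot whose bit is one holds exactly
    one selected tag. *)
Lemma card_moved m : {in selected q, forall t, h t < m} ->
  #|[set t in selected q | F m (h t)]| = prefix_count m m.
Proof.
move=> hm; transitivity (\sum_(j < m) \sum_(t in selected q) (h t == j) * F m j).
  rewrite exchange_big -sum1_card big_mkcond/= [RHS]big_mkcond/=.
  apply: eq_bigr => t _; rewrite inE; case: ifP => [/andP[ts Ft]|].
    rewrite ts (bigD1 (Ordinal (hm _ ts)))//= eqxx Ft big1// => j jt.
    by rewrite eq_sym; case: eqVneq => // jE; case/eqP: jt; apply: val_inj.
  case: ifP => //= ts Ft; rewrite big1// => j _.
  by case: eqVneq => // <-; rewrite Ft.
rewrite /prefix_count; apply: eq_bigr => j _.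
rewrite -big_distrl /=; have jm : j < m := ltn_ord j.
case Fj: (nth _ _ _); last by rewrite muln0.
move: Fj; rewrite nth_bitvec// => /andP[_ /eqP cj]; rewrite muln1.
rewrite -big_mkcondr/= sum1_card -[RHS]cj; apply: eq_card => t.
by rewrite !inE.
Qed.

End BitVector.

(** List each set before its complement and match equal positions of the two lists. *)
Lemma preim_perm_card_eq (T : finType) (A B : {set T}) :
  #|A| = #|B| -> exists s : {perm T}, s @^-1: A = B.
Proof.
move=> AB; pose l (D : {set T}) := enum D ++ enum (~: D).
have l_mem D t : t \in l D by rewrite mem_cat !mem_enum inE orbN.
have l_uniq D : uniq (l D).
  rewrite cat_uniq !enum_uniq andbT /=; apply/hasPn => t.
  by rewrite !mem_enum inE.
have l_size D : size (l D) = #|T| by rewrite size_cat -!cardE cardsC.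
have l_index D t : (index t (l D) < #|D|) = (t \in D).
  rewrite index_cat mem_enum; case: ifP => tD.
    by rewrite cardE index_mem mem_enum.
  by rewrite -cardE ltnNge leq_addr.
pose f t := nth t (l A) (index t (l B)).
have f_inj : injective f.
  move=> t u; rewrite /f (set_nth_default u) ?l_size -?(l_size B) ?index_mem//.
  move/eqP; rewrite nth_uniq ?l_size -?(l_size B) ?index_mem// => /eqP.
  by move/(congr1 (nth t (l B))); rewrite !nth_index.
exists (perm f_inj); apply/setP => t; rewrite inE permE -l_index AB.
by rewrite index_uniq ?l_index// l_size -(l_size B) index_mem.
Qed.

(** [inv_enough] keeps the quota [c] within reach; [inv_cnt_selected] makes the next counters
    continue right after those in use. *)
Record counting_inv (T : finType) (c : nat) (q : tags T) : Prop := CountingInv {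
  inv_disjoint : [disjoint selected q & ready q];
  inv_enough : c <= #|selected q| + #|ready q|;
  inv_ready_le : #|ready q| <= c;
  inv_cnt_selected : {in selected q, forall t, cnt q t = #|ready q|};
  inv_cnt_ready : {in ready q, forall t, 0 < cnt q t <= #|ready q|};
  inv_cnt_inj : {in ready q &, injective (cnt q)} }.

(** The counters inject the ready tags into equally many positive values, so every value is
    taken. *)
Lemma counting_inv_onto (T : finType) (c : nat) (q : tags T) k :
  counting_inv c q -> 0 < k <= #|ready q| ->
  exists2 t, t \in ready q & cnt q t = k.
Proof.
case=> _ _ _ _ cb ci; case/andP => k0 kr.
pose f t : 'I_#|ready q|.+1 := inord (cnt q t).
have fE : {in ready q, forall t, f t = cnt q t :> nat}.
  by move=> t /cb/andP[_ ?]; rewrite inordK.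
have finj : {in ready q &, injective f}.
  by move=> t t' tr t'r /(congr1 val)/=; rewrite !fE//; apply: ci.
have : f @: ready q == [set~ ord0].
  rewrite eqEcard card_in_imset// cardsC1 card_ord /= leqnn andbT.
     apply/subsetP => _ /imsetP[t tr ->]; rewrite !inE -val_eqE /= fE//.
  by have /andP[] := cb _ tr; rewrite lt0n.
move=> /eqP fr; have : inord k \in f @: ready q.
  by rewrite fr !inE -val_eqE /= inordK// -lt0n.
case/imsetP => t tr /(congr1 val); rewrite /= inordK// fE// => ->.
by exists t.
Qed.

(** * One iteration of round Q *)

Section Iteration.
Variables (T : finType) (c : nat) (h : T -> nat) (q : tags T).
Hypothesis q_inv : counting_inv c q.

Let m := #|selected q|.
Let slot t := h t %% m.
Let F := bitvec c q slot m.
Let moved := [set t in selected q | nth false F (slot t)].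

Let slot_lt : {in selected q, forall t, slot t < m}.
Proof. by move=> t ts; rewrite ltn_mod; apply/card_gt0P; exists t. Qed.

Let moved_selected t : t \in moved -> t \in selected q.
Proof. by rewrite inE => /andP[]. Qed.

Let card_movedE : #|moved| = prefix_count c q slot m m.
Proof. exact: card_moved slot_lt. Qed.

Lemma card_ready_iteration :
  #|ready (iteration c h q)| = #|ready q| + prefix_count c q slot m m.
Proof.
rewrite /= -/m -/slot -/F -/moved cardsU card_movedE.
have /setIidPl : ready q \subset ~: moved.
  apply/subsetP => t tr; rewrite inE; apply/negP => /moved_selected ts.
  by have /pred0P/(_ t)/= := inv_disjoint q_inv; rewrite ts tr.
rewrite -setDE => /setDidPl; rewrite -setI_eq0 => /eqP ->.
by rewrite cards0 subn0.
Qed.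

(** A moved tag gets [#|ready q|] plus the rank of its slot among the ones of [F]. This exceeds all
    earlier counters and is at most the new number of ready tags, which is also the value given to
    the tags that stay selected. *)
Lemma counting_inv_iteration : counting_inv c (iteration c h q).
Proof.
have rI := card_ready_iteration.
have movedC t : t \in moved -> t \notin ready q.
  move=> /moved_selected ts; apply/negP => tr.
  by have /pred0P/(_ t)/= := inv_disjoint q_inv; rewrite ts tr.
have cntM t : t \in moved -> cnt (iteration c h q) t
    = #|ready q| + prefix_count c q slot m (slot t).+1.
  move=> tm; rewrite /= ffunE -/m -/slot -/F -/moved tm.
  by rewrite (inv_cnt_selected q_inv (moved_selected tm)).
have cntR t : t \in ready q -> cnt (iteration c h q) t = cnt q t.
  move=> tr; rewrite /= ffunE -/m -/slot -/F -/moved.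
  case: ifP => [/movedC|_]; first by rewrite tr.
  case: ifP => // ts.
  by have /pred0P/(_ t)/= := inv_disjoint q_inv; rewrite ts tr.
have readyE t : t \in ready (iteration c h q) ->
    t \in ready q \/ t \in moved.
  by rewrite /= -/m -/slot -/F -/moved inE => /orP.
have prefixM t : t \in moved -> prefix_count c q slot m (slot t).+1
    = (prefix_count c q slot m (slot t)).+1.
  by rewrite inE prefix_countS => /andP[_ ->]; rewrite addn1.
split.
- rewrite /= -/m -/slot -/F -/moved; apply/pred0P => t /=; rewrite !inE.
  case: (boolP (t \in selected q)) => //= ts.
  have /pred0P/(_ t)/= := inv_disjoint q_inv; rewrite ts /= => ->.
  by case: (nth _ _ _).
- rewrite rI /= -/m -/slot -/F -/moved cardsDS -?card_movedE.
    have : #|moved| <= #|selected q|.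
      by apply/subset_leq_card/subsetP => t /moved_selected.
    have := inv_enough q_inv; rewrite -/m; lia.
  by apply/subsetP => t /moved_selected.
- by rewrite rI prefix_count_le// (inv_ready_le q_inv).
- move=> t; rewrite rI /= -/m -/slot -/F -/moved inE => /andP[tm ts].
  by rewrite ffunE (negbTE tm) ts (inv_cnt_selected q_inv ts).
- move=> t /readyE[tr|tm].
    rewrite cntR// rI; have := inv_cnt_ready q_inv tr; lia.
  rewrite cntM// rI prefixM// addnS /= -addnS -prefixM// leq_add2l.
  exact/prefix_count_mono/slot_lt/moved_selected.
- have mixed t u : t \in ready q -> u \in moved ->
      cnt (iteration c h q) t <> cnt (iteration c h q) u.
    move=> tr um; rewrite cntR// cntM// prefixM//.
    by have := inv_cnt_ready q_inv tr; lia.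
  move=> t u /readyE[tr|tm] /readyE[ur|um].
  + by rewrite !cntR//; apply: (inv_cnt_inj q_inv).
  + by move/mixed => /(_ tr um).
  + by move/esym/mixed => /(_ ur tm).
  + rewrite !cntM// => /addnI tu.
    (* Different slots would give different ranks, since the prefix count grows at each slot whose
       bit is one; and such a slot holds one tag only. *)
    have tF := tm; rewrite inE in tF; case/andP: tF => ts tF.
    have us := moved_selected um.
    apply: (nth_bitvec_inj (slot_lt ts)) tF _ => //.
    case: (ltngtP (slot t) (slot u)) => // lt_slot; move: tu.
      rewrite (prefixM u)//; have := @prefix_count_mono _ c q slot m _ _ lt_slot.
      by lia.
    rewrite (prefixM t)//; have := @prefix_count_mono _ c q slot m _ _ lt_slot.
    by lia.
Qed.

(** If the total stayed below [c], the quota would block no bit. An injection of [m] tags into [m]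
    slots is onto, so all bits would be one and all selected tags would become ready, against
    [inv_enough]. *)
Lemma iteration_completes : {in selected q &, injective slot} ->
  #|ready (iteration c h q)| = c.
Proof.
move=> slot_inj; rewrite card_ready_iteration.
have rc := inv_ready_le q_inv.
have le_c j : j <= m -> #|ready q| + prefix_count c q slot m j <= c.
  exact: prefix_count_le.
apply/eqP; rewrite eqn_leq le_c//= leqNgt; apply/negP => lt_c.
suff full : prefix_count c q slot m m = m.
  by have := inv_enough q_inv; rewrite -/m; lia.
rewrite /prefix_count -[RHS]card_ord -sum1_card; apply: eq_bigr => j _.
have jm : j < m := ltn_ord j.
rewrite nth_bitvec// -/(prefix_count _ _ _ _ _).
rewrite (leq_ltn_trans _ lt_c) ?leq_add2l ?prefix_count_mono ?(ltnW jm)//=.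
pose f t : 'I_m := insubd j (slot t).
have fE : {in selected q, forall t, f t = slot t :> nat}.
  by move=> t ts; rewrite /f val_insubd slot_lt.
have finj : {in selected q &, injective f}.
  by move=> t u ts us /(congr1 val)/=; rewrite !fE//; apply: slot_inj.
have : j \in f @: selected q.
  have /eqP -> // : f @: selected q == setT.
  by rewrite eqEcard subsetT cardsT card_ord card_in_imset/=.
case/imsetP => t ts jt; suff -> : [set u in selected q | slot u == j] = [set t].
  by rewrite cards1.
apply/setP => u; rewrite !inE; apply/andP/eqP => [[us /eqP uj]|->].
  by apply: slot_inj => //; rewrite uj jt fE.
by rewrite ts jt fE.
Qed.

End Iteration.

Definition state_inv (T : finType) (c : nat) (st : state T) : Prop :=
  match st with
  | Testing => True
  | Querying q => counting_inv c q /\ #|ready q| < c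
  | Stopped q => [/\ counting_inv c q, #|ready q| = c & selected q = set0]
  end.

(** * The finite chain obtained by forgetting the counters *)

Section Erasure.
Variables (R : rcfType) (T : finType) (c : nat).
Hypothesis c_bounds : 0 < c <= #|T|.

Lemma state_inv_check_stop (q : tags T) :
  counting_inv c q -> state_inv c (check_stop c q).
Proof.
rewrite /check_stop => qi; case: eqVneq => /= [rc|rc]; split=> //; last first.
  by rewrite ltn_neqAle rc (inv_ready_le qi).
case: qi => /= _ _ ? _ ? ?; split=> //=; last by move=> t; rewrite inE.
  by rewrite -setI_eq0 set0I.
by rewrite cards0 rc.
Qed.

Lemma state_inv_step (h : T -> nat) (st : state T) :
  state_inv c st -> state_inv c (step R c h st).
Proof.
case: st => [_|q [qi _]|//] /=; last first.
  exact/state_inv_check_stop/counting_inv_iteration.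
case: ifP => // /andP[cS _]; apply: state_inv_check_stop; split=> /=.
- by rewrite -setI_eq0 setI0.
- by rewrite cards0 addn0.
- by rewrite cards0.
- by move=> t _; rewrite ffunE cards0.
- by move=> t; rewrite inE.
- by move=> t u; rewrite inE.
Qed.

Lemma state_inv_run (h : nat -> T -> nat) N : state_inv c (run R c h N).
Proof. by elim: N => //= N; apply: state_inv_step. Qed.

(* The counters influence neither F nor the stopping test, so forgetting them
   leaves a Markov chain on a finite type; the boolean marks [Stopped]. *)
Definition erased := option (bool * {set T} * {set T}).

Definition erase (st : state T) : erased :=
  match st with
  | Testing => None
  | Querying q => Some (false, selected q, ready q)
  | Stopped q => Some (true, selected q, ready q)
  end.

Definition unerase (a : erased) : state T :=
  match a with
  | None => Testing T
  | Some (b, U, A) =>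
      (if b then @Stopped T else @Querying T) (Tags U A [ffun=> 0])
  end.

Definition erased_step (h : T -> nat) (a : erased) : erased :=
  erase (step R c h (unerase a)).

(** The tags enter [F] only through the number of ready tags and the occupancy of each slot. This
    serves for erased counters, for congruent hash values and for permuted tags. *)
Lemma bitvec_eq (q q' : tags T) (h h' : T -> nat) m :
  #|ready q| = #|ready q'| ->
  (forall j, #|[set t in selected q | h t == j]|
             = #|[set t in selected q' | h' t == j]|) ->
  bitvec c q h m = bitvec c q' h' m.
Proof. by move=> rr ss; elim: m => //= m ->; rewrite rr ss. Qed.

Lemma erase_check_stop (q q' : tags T) :
  selected q = selected q' -> ready q = ready q' ->
  erase (check_stop c q) = erase (check_stop c q').
Proof.
by rewrite /check_stop => ss rr; rewrite -rr; case: ifP => //= _; rewrite ss rr.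
Qed.

Lemma erase_step h st : erase (step R c h st) = erased_step h (erase st).
Proof.
rewrite /erased_step; case: st => [//|q|//] /=.
have bE m : bitvec c (Tags (selected q) (ready q) [ffun=> 0])
    (fun t => h t %% #|selected q|) m
    = bitvec c q (fun t => h t %% #|selected q|) m by exact: bitvec_eq.
by apply: erase_check_stop; rewrite /= bE.
Qed.

(* The hash values matter modulo (predn_modulus a).+1 only.  When no tag is
   selected this number is 1 instead of 0, and the hash values are irrelevant. *)
Definition predn_modulus (a : erased) : nat :=
  if a is Some (_, U, _) then #|U|.-1 else #|T|.-1.

Lemma predn_modulus_lt a : predn_modulus a < #|T|.
Proof.
have T0 : 0 < #|T| by lia.
case: a => [[[b U] A]|] /=; last by rewrite prednK.
apply: (@leq_ltn_trans #|T|.-1); last by rewrite prednK.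
by rewrite -!subn1 leq_sub2r// max_card.
Qed.

Lemma eq_erased_step (h h' : T -> nat) a :
  (forall t, h t = h' t %[mod (predn_modulus a).+1]) ->
  erased_step h a = erased_step h' a.
Proof.
case: a => [[[[] U] A]|] //; last first.
  rewrite /predn_modulus prednK => [hh|]; last by lia.
  rewrite /erased_step /=; suff -> : selection R c h = selection R c h' by [].
  by apply/setP => t; rewrite !inE hh.
rewrite /predn_modulus; have [U0 _|U_gt0 hh] := posnP #|U|.
  have -> : U = set0 by apply/eqP; rewrite -cards_eq0 U0.
  apply: erase_check_stop => /=; first by rewrite !setD0 || rewrite !set0D.
  by congr (_ :|: _); apply/setP => t; rewrite !inE.
rewrite prednK// in hh.
have bE m : bitvec c (Tags U A [ffun=> 0]) (fun t => h t %% #|U|) m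
          = bitvec c (Tags U A [ffun=> 0]) (fun t => h' t %% #|U|) m.
  by apply: bitvec_eq => //= j; apply: eq_card => t; rewrite !inE hh.
apply: erase_check_stop => /=; rewrite bE;
  by congr (_ _ _ _); apply/setP => t; rewrite !inE hh.
Qed.

(** * Symmetry under permutations of the tags *)

Definition erased_preim (s : {perm T}) (a : erased) : erased :=
  if a is Some (b, U, A) then Some (b, s @^-1: U, s @^-1: A) else None.

Lemma card_preim_perm (s : {perm T}) (A : {set T}) : #|s @^-1: A| = #|A|.
Proof. exact/card_preimset/perm_inj. Qed.

Lemma erased_preim_inj (s : {perm T}) : injective (erased_preim s).
Proof.
have sI (A B : {set T}) : s @^-1: A = s @^-1: B -> A = B.
  by move=> /setP AB; apply/setP => t; have := AB (s^-1%g t); rewrite !inE permKV.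
by case=> [[[b U] A]|] [[[b' U'] A']|] //= [-> /sI -> /sI ->].
Qed.

Lemma predn_modulus_preim s a : predn_modulus (erased_preim s a) = predn_modulus a.
Proof. by case: a => [[[b U] A]|] //=; rewrite card_preim_perm. Qed.

(** The selection and the set of moved tags are pulled back by [s], while sizes and slot
    occupancies, hence [F], stay the same. *)
Lemma erased_step_preim (s : {perm T}) (h : T -> nat) a :
  erased_step (h \o s) (erased_preim s a) = erased_preim s (erased_step h a).
Proof.
case: a => [[[[] U] A]|] //=; rewrite /erased_step /=; last first.
  have selE : selection R c (h \o s) = s @^-1: selection R c h.
    by apply/setP => t; rewrite !inE.
  rewrite selE /good_selection card_preim_perm; case: ifP => //= _.
  rewrite /check_stop /= cards0; case: ifP => _ /=; last by rewrite preimset0.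
  by rewrite preimset0.
have bE m : bitvec c (Tags (s @^-1: U) (s @^-1: A) [ffun=> 0])
      (fun t => h (s t) %% #|U|) m
    = bitvec c (Tags U A [ffun=> 0]) (fun t => h t %% #|U|) m.
  apply: bitvec_eq => [|j] /=; first by rewrite card_preim_perm.
  by rewrite -[RHS](card_preim_perm s); apply: eq_card => t; rewrite !inE.
rewrite /check_stop /= card_preim_perm bE.
have mE : [set t in s @^-1: U | nth false
      (bitvec c (Tags U A [ffun=> 0]) (fun t => h t %% #|U|) #|U|) (h (s t) %% #|U|)]
    = s @^-1: [set t in U | nth false
      (bitvec c (Tags U A [ffun=> 0]) (fun t => h t %% #|U|) #|U|) (h t %% #|U|)].
  by apply/setP => t; rewrite !inE.
rewrite mE -preimsetU card_preim_perm; case: ifP => _ /=.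
  by rewrite preimset0.
by rewrite card_preim_perm bE mE preimsetD preimsetU.
Qed.

(** * Residue patterns that make progress *)

Definition is_stopped (a : erased) : bool :=
  if a is Some (b, _, _) then b else false.

Lemma testing_progress :
  exists g : {ffun T -> 'I_(predn_modulus None).+1},
    erased_step (fun t => g t) None != None.
Proof.
suff [g gP] : exists g : {ffun T -> 'I_(predn_modulus None).+1},
    good_selection R c (selection R c (fun t => g t)).
  by exists g; rewrite /erased_step /= gP /check_stop; case: ifP.
case/andP: c_bounds => c0 cn; have nE : #|T|.-1.+1 = #|T| by lia.
have c_sqrt : (1 <= Num.sqrt c%:R :> R)%R.
  by rewrite -[X in (X <= _)%R]sqrtr1 ler_sqrt ?ler1n// ltr0n.
(* If the largest residue is within the threshold, selecting all tags is acceptable: there are at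
   most [c + 3 * sqrt c + 1] of them, and [sqrt c >= 1]. Otherwise the threshold separates the
   residues 0 and [#|T|.-1], so exactly [c] tags can be singled out. *)
have [small|large] := lerP (#|T|.-1%:R : R) (c%:R + 3%:R * Num.sqrt c%:R)%R.
  exists [ffun=> ord0]; set U := selection _ _ _; suff -> : U = setT.
    rewrite /good_selection cardsT cn /= -nE -natr1.
    by move: small c_sqrt; set x := Num.sqrt _; lra.
  apply/setP => t; rewrite !inE ffunE mod0n.
  by rewrite addr_ge0// mulr_ge0// sqrtr_ge0.
have /card_gt0P[A] : 0 < #|[set A : {set T} | #|A| == c]|.
  by rewrite card_draws bin_gt0.
rewrite inE => /eqP cA; exists [ffun t => if t \in A then ord0 else ord_max].
set U := selection _ _ _; suff -> : U = A.
  by rewrite /good_selection cA leqnn /= lerDl mulr_ge0// sqrtr_ge0.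
apply/setP => t; rewrite !inE ffunE; case: (t \in A) => /=.
  by rewrite mod0n addr_ge0// mulr_ge0// sqrtr_ge0.
by rewrite modn_small ?leNgt ?large// (predn_modulus_lt None).
Qed.

(** Ranking the selected tags gives each its own slot, and then a single iteration fills the
    quota. *)
Lemma querying_progress (q : tags T) : state_inv c (Querying q) ->
  exists g : {ffun T -> 'I_(predn_modulus (erase (Querying q))).+1},
    is_stopped (erased_step (fun t => g t) (erase (Querying q))).
Proof.
case=> qi rc; have /card_gt0P[t0 t0s] : 0 < #|selected q|.
  by have := inv_enough qi; lia.
have mE : (predn_modulus (erase (Querying q))).+1 = #|selected q|.
  by rewrite /= prednK//; apply/card_gt0P; exists t0.
exists [ffun t => inord (enum_rank_in t0s t)].
set g := finfun _; rewrite -erase_step /= /check_stop iteration_completes ?eqxx//.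
have gE t : t \in selected q -> g t %% #|selected q| = enum_rank_in t0s t.
  by move=> ts; rewrite ffunE inordK ?mE ?modn_small.
by move=> t u ts us; rewrite !gE// => /val_inj; apply: enum_rank_in_inj.
Qed.

End Erasure.

From mathcomp Require Import all_classical all_reals all_analysis.

Import numFieldNormedType.Exports.

Local Open Scope classical_set_scope.
Local Open Scope ring_scope.

Lemma measure_finite_partition (R : realType) (d : measure_display)
    (Omega : measurableType d) (P : probability Omega R)
    (S : finType) (Z : Omega -> S) (A : set Omega) :
  (forall a, measurable [set w | Z w = a]) -> measurable A ->
  P A = (\sum_(a : S) P (A `&` [set w | Z w = a]))%E.
Proof.
move=> mZ mA.
have mAZ a : measurable (A `&` [set w | Z w = a]) by exact: measurableI.
have {1}-> : A = \bigcup_(a in [set: S]) (A `&` [set w | Z w = a]).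
  by apply/seteqP; split=> [w Aw|w [a _ []//]]; exists (Z w).
rewrite measure_fin_bigcup//; [|exact: finite_finset|].
  by rewrite (fsbigE (index_enum S)) ?index_enum_uniq//;
    [under eq_bigl do rewrite in_setT | move=> i _; rewrite mem_index_enum].
by apply/trivIsetP => a b _ _ ab; apply/seteqP; split=> w //= [[_ za] [_ zb]];
  rewrite -za -zb eqxx in ab.
Qed.

(** * Chains driven by independent inputs *)

Section RandomIteration.
Variables (R : realType) (d : measure_display) (Omega : measurableType d).
Variables (P : probability Omega R) (V : countType) (X : nat -> Omega -> V).
Hypothesis X_indep : mutually_independent P X.
Hypothesis X_meas : forall s (B : set V), measurable [set w | B (X s w)].
Variables (S : finType) (F : V -> S -> S) (z0 : S).

Fixpoint chain (N : nat) (w : Omega) : S :=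
  if N is N'.+1 then F (X N' w) (chain N' w) else z0.

Lemma measurable_chain N (B : set S) : measurable [set w | B (chain N w)].
Proof.
elim: N B => [|N IHN] B /=.
  have [Bz|nBz] := pselect (B z0).
    by have -> : [set _ | B z0] = [set: Omega] by apply/seteqP; split.
  by have -> : [set _ | B z0] = @set0 Omega by apply/seteqP; split.
have -> : [set w | B (F (X N w) (chain N w))] = \bigcup_(a in [set: S])
    ([set w | chain N w = a] `&` [set w | B (F (X N w) a)]).
  apply/seteqP; split=> [w Bw|w [a _ [/= <-]//]].
  by exists (chain N w).
apply: fin_bigcup_measurable => [|a _]; first exact: finite_finset.
by apply: measurableI; [exact: (IHN [set a])|exact: (X_meas N (fun x => B (F x a)))].
Qed.

Lemma measurable_future (J : seq nat) (B : nat -> set V) :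
  measurable [set w | forall i : nat, i \in J -> B i (X i w)].
Proof.
elim: J => [|j J IHJ].
  by have -> : [set w | forall i : nat, i \in [::] -> B i (X i w)] = [set: Omega]
    by apply/seteqP; split.
have -> : [set w | forall i : nat, i \in j :: J -> B i (X i w)]
    = [set w | B j (X j w)] `&` [set w | forall i : nat, i \in J -> B i (X i w)].
  apply/seteqP; split=> w /=.
    move=> h; split=> [|i iJ]; first by apply: h; rewrite mem_head.
    by apply: h; rewrite inE iJ orbT.
  by move=> [hj hJ] i; rewrite inE => /predU1P[->|/hJ].
exact: measurableI.
Qed.

(* Events on the seeds not yet used are carried through the induction, so that
   mutual independence of single seeds suffices. *)
Lemma chain_indep_future N a (J : seq nat) (B : nat -> set V) :
  uniq J -> {in J, forall i, (N <= i)%N} ->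
  P ([set w | chain N w = a] `&` [set w | forall i : nat, i \in J -> B i (X i w)])
  = (P [set w | chain N w = a] * \prod_(i <- J) P [set w | B i (X i w)])%E.
Proof.
elim: N a J B => [|N IHN] a J B uJ NJ /=.
  rewrite -X_indep//; have [za|za] := pselect (z0 = a).
    have -> : [set _ | z0 = a] = [set: Omega] by apply/seteqP; split.
    by rewrite setTI probability_setT mul1e.
  have -> : [set _ | z0 = a] = @set0 Omega by apply/seteqP; split.
  by rewrite set0I measure0 mul0e.
have mC b := measurable_chain N [set b].
rewrite (measure_finite_partition _ (mC)); last first.
  apply: measurableI (measurable_future _ _).
  exact: (measurable_chain N.+1 [set a]).
have mS := measurable_chain N.+1 [set a]; rewrite /= in mS.
rewrite [in RHS](measure_finite_partition _ mC mS).
rewrite ge0_sume_distrl//; apply: eq_bigr => b _.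
have NnJ : N \notin J by apply/negP => /NJ; rewrite ltnn.
(* Given the state [b] at time [N], the move to [a] is an event on input [N] alone, so it joins the
   conditions on the inputs in [J]. *)
pose B' i := if i == N then [set x | F x b = a] else B i.
have B'J : (\prod_(i <- J) P [set w | B' i (X i w)]
         = \prod_(i <- J) P [set w | B i (X i w)])%E.
  rewrite big_seq [RHS]big_seq; apply: eq_bigr => i iJ; rewrite /B'.
  by case: eqVneq => // iN; rewrite -iN iJ in NnJ.
have B'N : B' N = [set x | F x b = a] by rewrite /B' eqxx.
have -> : [set w | F (X N w) (chain N w) = a] `&`
    [set w | forall i : nat, i \in J -> B i (X i w)] `&` [set w | chain N w = b] =
    [set w | chain N w = b] `&`
    [set w | forall i : nat, i \in N :: J -> B' i (X i w)].
  apply/seteqP; split=> w /=.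
    move=> [[Fa hJ] cb]; split=> // i; rewrite inE /B' cb in Fa *.
    by case: eqVneq => [->//|_ /= /hJ].
  move=> [cb h]; split=> //; split.
    by have := h N; rewrite mem_head B'N cb => /(_ isT).
  move=> i iJ; have := h i; rewrite inE iJ orbT /B' => /(_ isT).
  by case: eqVneq => // iN; rewrite -iN iJ in NnJ.
have -> : [set w | F (X N w) (chain N w) = a] `&` [set w | chain N w = b] =
    [set w | chain N w = b] `&`
    [set w | forall i : nat, i \in [:: N] -> B' i (X i w)].
  apply/seteqP; split=> w /=.
    by move=> [Fa cb]; split=> // i; rewrite inE => /eqP ->; rewrite B'N -cb.
  by move=> [cb /(_ N)]; rewrite mem_head B'N cb => /(_ isT).
rewrite (IHN b (N :: J) B') ?(IHN b [:: N] B')//=.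
- by rewrite big_cons big_seq1 B'J muleA.
- by move=> i; rewrite inE => /eqP ->.
- by rewrite NnJ.
- by move=> i; rewrite inE => /predU1P[->//|/NJ /ltnW].
Qed.

(** Total probability over the state at time [N], of which input [N] is independent. *)
Lemma chain_step N b :
  P [set w | chain N.+1 w = b] =
  (\sum_(a : S) P [set w | chain N w = a] * P [set w | F (X N w) a = b])%E.
Proof.
rewrite (measure_finite_partition _ (fun a => measurable_chain N [set a])); last first.
  exact: (measurable_chain N.+1 [set b]).
apply: eq_bigr => a _.
have := @chain_indep_future N a [:: N] (fun=> [set x | F x a = b]).
rewrite big_seq1 => <-//; last by move=> i; rewrite inE => /eqP ->.
congr (P _); apply/seteqP; split=> w /=.
  by move=> [Fb ca]; split=> // i; rewrite inE => /eqP ->; rewrite -ca.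
by move=> [ca /(_ N)]; rewrite mem_head ca => /(_ isT).
Qed.

(** An injective [tau] permutes the finite type [S], so the transition sum can be reindexed by
    it. *)
Lemma chain_symmetry (tau : S -> S) : injective tau -> tau z0 = z0 ->
  (forall N a b, P [set w | F (X N w) (tau a) = tau b]
                 = P [set w | F (X N w) a = b]) ->
  forall N b, P [set w | chain N w = tau b] = P [set w | chain N w = b].
Proof.
move=> tau_inj tau0 tauF; elim=> [|N IHN] b.
  congr (P _); apply/seteqP; split=> w /= zb; last by rewrite -zb tau0.
  by apply: tau_inj; rewrite tau0.
rewrite !chain_step (reindex_inj tau_inj)/=.
by apply: eq_bigr => a _; rewrite IHN tauF.
Qed.

(** The drift is assumed only at states that are reached, so that invariants of runs can serve to
    prove it; any other state has probability 0. *)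
Lemma chain_potential (phi : S -> R) (r : R) :
  (forall N w, let a := chain N w in
    \sum_b fine (P [set w' | F (X N w') a = b]) * phi b <= r * phi a) ->
  0 <= r -> forall N,
  \sum_a fine (P [set w | chain N w = a]) * phi a <= r ^+ N * phi z0.
Proof.
move=> drift r0; elim=> [|N IHN].
  rewrite expr0 mul1r (bigD1 z0)//= big1 => [|a az].
    have -> : [set _ | z0 = z0] = [set: Omega] by apply/seteqP; split.
    by rewrite probability_setT mul1r addr0.
  have -> : [set _ | z0 = a] = @set0 Omega.
    by apply/seteqP; split=> // w /= za; rewrite za eqxx in az.
  by rewrite measure0 mul0r.
rewrite exprS -mulrA (le_trans _ (ler_wpM2l r0 IHN))//.
have mF a b : measurable [set w | F (X N w) a = b].
  exact: (X_meas N (fun x => F x a = b)).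
have mC a : measurable [set w | chain N w = a].
  exact: (measurable_chain N [set a]).
have stepE b : fine (P [set w | chain N.+1 w = b]) = \sum_a
    fine (P [set w | chain N w = a]) * fine (P [set w | F (X N w) a = b]).
  rewrite chain_step -sum_fine => [|a _].
    by apply: eq_bigr => a _; rewrite fineM ?fin_num_measure.
  by rewrite fin_numM// fin_num_measure.
rewrite (eq_bigr _ (fun b _ => congr1 (fun x => x * phi b) (stepE b))).
under eq_bigr do rewrite mulr_suml.
rewrite exchange_big/= mulr_sumr; apply: ler_sum => a _.
have [[w <-]|noa] := pselect (exists w, chain N w = a).
  rewrite mulrCA; under eq_bigr do rewrite -mulrA.
  by rewrite -mulr_sumr ler_wpM2l ?fine_ge0//; exact: drift.
have -> : [set w | chain N w = a] = set0.
  by apply/seteqP; split=> // w /= wa; apply: noa; exists w.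
rewrite measure0 /= mul0r mulr0 big1// => b _.
by rewrite !mul0r.
Qed.

End RandomIteration.

(** * The protocol as a random chain *)

Section HashedProtocol.
Variables (R : realType) (T : finType) (c : nat).
Variables (d : measure_display) (Omega : measurableType d).
Variables (P : probability Omega R) (H : nat -> T -> {RV P >-> nat}).
Hypotheses (c_bounds : (0 < c <= #|T|)%N) (idealH : ideal_hash H).

Definition hash_vector (s : nat) (w : Omega) : {ffun T -> nat} :=
  [ffun t => H s t w].

Definition transition (x : {ffun T -> nat}) : erased T -> erased T :=
  erased_step R c x.

Local Notation Z := (chain hash_vector transition None).

(** Hash vectors form a countable type, and each single vector is a finite intersection of events on
    single tags. *)
Lemma measurable_hash_vector s (B : set {ffun T -> nat}) :
  measurable [set w | B (hash_vector s w)].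
Proof.
have -> : [set w | B (hash_vector s w)]
    = \bigcup_(f in B) [set w | hash_vector s w = f].
  by apply/seteqP; split=> [w Bw|w [f Bf /= ->//]]; exists (hash_vector s w).
rewrite bigcup_mkcond; apply: countable_bigcupT_measurable => [|f].
  exact: countableP.
case: ifP => // _.
have -> : [set w | hash_vector s w = f]
    = \bigcap_(t in [set: T]) [set w | H s t w = f t].
  apply/seteqP; split=> w /= => [<- t _ /=|wf]; first by rewrite ffunE.
  by apply/ffunP => t; rewrite ffunE; exact: wf.
apply: fin_bigcap_measurable => [|t _]; first exact: finite_finset.
exact: (@measurable_funPTI _ _ _ _ (H s t) [set f t]).
Qed.

Definition residues (k s : nat) (w : Omega) : {ffun T -> 'I_k.+1} :=
  [ffun t => inord (H s t w %% k.+1)].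

Lemma measurable_residues k s g : measurable [set w | residues k s w = g].
Proof.
have -> : [set w | residues k s w = g] = [set w |
    [set x : {ffun T -> nat} | [ffun t => inord (x t %% k.+1)] = g]
      (hash_vector s w)].
  by apply/seteqP; split=> w /= <-; apply/ffunP => t; rewrite !ffunE.
exact: measurable_hash_vector.
Qed.

(** Independence within one seed gives one uniform factor per tag. *)
Lemma probability_residues k s g : (k < #|T|)%N ->
  P [set w | residues k s w = g] = ((k.+1%:R^-1) ^+ #|T|)%:E.
Proof.
move=> kT; case: idealH => unif indep _.
have -> : [set w | residues k s w = g]
    = [set w | forall t, t \in enum T ->
                 [set v | v = g t :> nat] (H s t w %% k.+1)%N].
  apply/seteqP; split=> w /= => [<- t _|wg].
    by rewrite ffunE inordK ?ltn_mod.
  by apply/ffunP => t; rewrite ffunE wg ?mem_enum// inord_val.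
apply: etrans (indep s k.+1 kT (enum T)
  (fun t => [set v | v = g t :> nat]) (enum_uniq _)) _.
rewrite (eq_bigr (fun=> (k.+1%:R^-1)%:E)) => [|t _]; last first.
  by rewrite /= unif.
by rewrite prodEFin big_const_seq count_predT -cardE iter_mulr_1.
Qed.

Lemma transition_residues s a w :
  transition (hash_vector s w) a
  = erased_step R c (fun t => residues (predn_modulus a) s w t) a.
Proof.
apply: eq_erased_step => // t.
by rewrite !ffunE inordK ?modn_mod// ltn_mod.
Qed.

(** The next state is a function of the residue pattern, so each pattern either lies in the event or
    misses it. *)
Lemma transition_law s k a b : predn_modulus a = k ->
  P [set w | transition (hash_vector s w) a = b]
  = (\sum_(g : {ffun T -> 'I_k.+1} | erased_step R c (fun t => g t) a == b)
       (k.+1%:R^-1) ^+ #|T|)%:E.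
Proof.
move=> ak; have kT : (k < #|T|)%N by rewrite -ak (predn_modulus_lt c_bounds).
rewrite (measure_finite_partition _ (@measurable_residues k s)); last first.
  exact: (measurable_hash_vector s (fun x => transition x a = b)).
rewrite -sumEFin [RHS]big_mkcond/=; apply: eq_bigr => g _.
case: eqVneq => [gb|gb].
  rewrite -(@probability_residues k s g kT); congr (P _).
  apply/seteqP; split=> w /= => [[]//|wg]; split=> //.
  by rewrite transition_residues ak wg.
rewrite (_ : _ `&` _ = set0) ?measure0//.
apply/seteqP; split=> w //= [wb wg]; case/eqP: gb.
by rewrite -wb transition_residues ak wg.
Qed.

(** Precomposition with [s] permutes the residue patterns and carries those leading from [a] to [b]
    onto those between the preimages. *)
Lemma transition_preim (s : {perm T}) N a b :
  P [set w | transition (hash_vector N w) (erased_preim s a) = erased_preim s b]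
  = P [set w | transition (hash_vector N w) a = b].
Proof.
rewrite (transition_law _ _ (predn_modulus_preim s a)) (transition_law _ _ erefl).
set k := predn_modulus a; pose u (g : {ffun T -> 'I_k.+1}) := [ffun t => g (s t)].
have u_inj : injective u.
  move=> g g' /ffunP gg'; apply/ffunP => t; have := gg' (s^-1%g t).
  by rewrite !ffunE permKV.
rewrite (reindex_inj u_inj)/=; congr (_ %:E); apply: eq_bigl => g.
rewrite -[RHS](inj_eq (@erased_preim_inj _ s)) -erased_step_preim//.
congr (_ == _); apply: eq_erased_step => // t.
by rewrite ffunE.
Qed.

(* A lower bound, uniform in the modulus, for the probability of each residue
   pattern. *)
Local Notation e := ((#|T|%:R^-1) ^+ #|T| : R).

(** The modulus is at most [#|T|], so the pattern [g] alone has probability at least [e]. *)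
Lemma transition_lower s a (g : {ffun T -> 'I_(predn_modulus a).+1}) :
  e <= fine (P [set w | transition (hash_vector s w) a
                        = erased_step R c (fun t => g t) a]).
Proof.
rewrite (transition_law _ _ erefl) /= (bigD1 g)//=.
rewrite -[leLHS]addr0 lerD//; last by apply: sumr_ge0 => i _; rewrite exprn_ge0.
have T0 : (0 < #|T|)%N by lia.
rewrite lerXn2r ?nnegrE ?invr_ge0// lef_pV2 ?posrE ?ltr0n// ler_nat.
exact: predn_modulus_lt c_bounds a.
Qed.

Lemma chain_run N w : Z N w = erase (run R c (fun s t => H s t w) N).
Proof.
elim: N => //= N ->; rewrite erase_step /transition.
by apply: eq_erased_step => // t; rewrite ffunE.
Qed.

(** The bound on [phi] carries the factor [p b], so that it holds trivially at impossible
    successors. *)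
Lemma transition_fine_sum s a (phi : erased T -> R) (M D : R) (b0 : erased T) :
  let p b := fine (P [set w | transition (hash_vector s w) a = b]) in
  0 <= D -> e <= p b0 ->
  (forall b, p b * phi b <= p b * (M - D * (b == b0)%:R)) ->
  \sum_b p b * phi b <= M - D * e.
Proof.
move=> p D0 pb0 phi_le.
have mp b : measurable [set w | transition (hash_vector s w) a = b].
  exact: (measurable_hash_vector s (fun x => transition x a = b)).
have p1 : \sum_b p b = 1.
  rewrite sum_fine => [|b _]; last exact: fin_num_measure.
  have := @measure_finite_partition _ _ _ P _
    (fun w => transition (hash_vector s w) a) _ mp measurableT.
  rewrite probability_setT => /(congr1 fine) /= ->.
  by congr fine; apply: eq_bigr => b _; rewrite setTI.
apply: (@le_trans _ _ (\sum_b p b * (M - D * (b == b0)%:R))).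
  by apply: ler_sum => b _; exact: phi_le.
under eq_bigr do rewrite mulrBr; rewrite sumrB -mulr_suml p1 mul1r lerD2l lerN2.
rewrite (bigD1 b0)//= eqxx mulr1 big1 => [|b /negbTE ->]; last by rewrite !mulr0.
by rewrite addr0 mulrC ler_wpM2r.
Qed.

(* The weight 2 / e of the testing state absorbs the increase of the potential
   caused by the transition to a querying state of weight 1. *)
Definition potential (a : erased T) : R :=
  match a with
  | None => 2 / e
  | Some (b, _, _) => (~~ b)%:R
  end.

Lemma e_bounds : 0 < e <= 1.
Proof.
have T0 : (0 < #|T|)%N by lia.
by rewrite exprn_gt0 ?exprn_ile1 ?invr_gt0 ?invr_ge0 ?ltr0n// invf_le1 ?ler1n ?ltr0n.
Qed.

Lemma potential_drift N w : let a := Z N w in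
  \sum_b fine (P [set w' | transition (hash_vector N w') a = b]) * potential b
  <= (1 - e / 2) * potential a.
Proof.
have /andP[e0 e1] := e_bounds.
rewrite /= chain_run.
have := state_inv_run R c (fun s t => H s t w) N.
case: (run _ _ _ _) => [_|q q_inv|q _].
- have [g] := testing_progress R c_bounds.
  have := transition_lower N g; set b0 := erased_step _ _ _ _ => pb0 b0N.
  have K1 : 1 <= 2 / e by rewrite ler_pdivlMr// mul1r; lra.
  (* From [M = 2 / e] the potential drops by at least [D = 2 / e - 1] at [b0], which has left
     testing. The mean is at most [2 / e - 2 + e], hence at most [2 / e - 1] since [e <= 1]. *)
  apply: le_trans
    (@transition_fine_sum N None potential (2 / e) (2 / e - 1) b0 _ pb0 _) _.
  - lra.
  - move=> b; rewrite ler_wpM2l ?fine_ge0//; case: eqVneq => [->|_].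
      rewrite mulr1; have : potential b0 <= 1.
        by case: b0 b0N {pb0} => [[[b' U] A]|//] _; case: b' => /=.
      lra.
    by rewrite mulr0 subr0; case: b => [[[[] U] A]|] /=; lra.
  - have : 2 / e * e = 2 by rewrite divfK// gt_eqF.
    by rewrite /=; move: (2 / e) (e) e1 => K x x1; nra.
- have [g] := querying_progress R c_bounds q_inv.
  have := transition_lower N g; set b0 := erased_step _ _ _ _ => pb0 b0s.
  (* Possible successors have potential at most 1, and [b0] is stopped, with potential 0. *)
  apply: le_trans (@transition_fine_sum N _ potential 1 1 b0 _ pb0 _) _.
  - by [].
  - move=> [[[b U] A]|].
      rewrite ler_wpM2l ?fine_ge0//; case: eqVneq => [bb0|_].
        by move: b0s; rewrite -bb0 /= => ->; rewrite mulr1 subrr.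
      by rewrite mulr0 subr0; case: (b).
    (* A querying state never returns to testing. *)
    rewrite [X in P X](_ : _ = set0) ?measure0 ?mul0r//.
    apply/seteqP; split=> w' //=.
    rewrite /transition -(erase_step R c _ (Querying q)) /=.
    by rewrite /check_stop; case: ifP.
  - rewrite /=; lra.
(* A stopped state is absorbing and has potential 0. *)
- rewrite /= mulr0 big1// => b _.
  have [->|ba] := eqVneq b (erase (Stopped q)); first by rewrite mulr0.
  rewrite [X in P X](_ : _ = set0) ?measure0 ?mul0r//.
  by apply/seteqP; split=> w' //= ab; rewrite -ab eqxx in ba.
Qed.

(** * Almost sure stopping and uniformity of the final set *)

Definition stopped_with (A : {set T}) : erased T := Some (true, finset.set0, A).

Lemma erase_stopped_with (h : nat -> T -> nat) N A :
  erase (run R c h N) = stopped_with A <->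
  exists2 q, run R c h N = Stopped q & ready q = A.
Proof.
split=> [|[q hq <-]]; last first.
  by have := state_inv_run R c h N; rewrite hq => -[_ _] /= ->.
by case: (run _ _ _ _) => //= q [_ qA]; exists q.
Qed.

Lemma is_stopped_erase (h : nat -> T -> nat) N :
  is_stopped (erase (run R c h N)) <-> exists q, run R c h N = Stopped q.
Proof.
split=> [|[q ->]//].
by case: (run _ _ _ _) => //= q _; exists q.
Qed.

Let measurable_Z N (B : set (erased T)) : measurable [set w | B (Z N w)].
Proof. by apply: measurable_chain; exact: measurable_hash_vector. Qed.

(** Some permutation pulls [A] back to [B]; it fixes the testing state and preserves the transition
    probabilities. *)
Lemma stopped_with_uniform N (A B : {set T}) : #|A| = #|B| ->
  P [set w | Z N w = stopped_with A] = P [set w | Z N w = stopped_with B].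
Proof.
case: idealH => _ _ indepH /preim_perm_card_eq[s <-].
have -> : stopped_with (s @^-1: A) = erased_preim s (stopped_with A).
  by rewrite /= preimset0.
symmetry; apply: chain_symmetry => //.
- exact: measurable_hash_vector.
- exact: erased_preim_inj.
- exact: transition_preim.
Qed.

(** Split by the ready set: only [c]-subsets occur on stopping, and they are equally likely. *)
Lemma probability_is_stopped N (A : {set T}) : #|A| = c ->
  P [set w | is_stopped (Z N w)]
  = ('C(#|T|, c)%:R%:E * P [set w | Z N w = stopped_with A])%E.
Proof.
move=> cA; pose rdy (a : erased T) := if a is Some (_, _, B) then B else finset.set0.
rewrite (@measure_finite_partition _ _ _ _ _ (fun w => rdy (Z N w))); last 2 first.
- by move=> B; exact: (measurable_Z N (fun a => rdy a = B)).
- exact: (measurable_Z N (fun a => is_stopped a)).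
have E (B : {set T}) : P ([set w | is_stopped (Z N w)] `&` [set w | rdy (Z N w) = B])
    = if #|B| == c then P [set w | Z N w = stopped_with A] else 0%E.
  case: eqVneq => [cB|cB].
    rewrite (@stopped_with_uniform N A B) ?cA//; congr (P _).
    apply/seteqP; split=> w /=; rewrite chain_run; last by move=> ->.
    move=> [/is_stopped_erase[q hq] rq]; apply/erase_stopped_with; exists q => //.
    by rewrite -rq hq.
  rewrite (_ : _ `&` _ = set0) ?measure0//; apply/seteqP; split=> w //=.
  rewrite chain_run => -[/is_stopped_erase[q hq] rq]; case/eqP: cB.
  have := state_inv_run R c (fun s t => H s t w) N.
  by rewrite -rq hq => -[].
rewrite (eq_bigr _ (fun B _ => E B)) -big_mkcond/=.
have fin : P [set w | Z N w = stopped_with A] \is a fin_num.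
  exact/fin_num_measure/(measurable_Z N [set stopped_with A]).
rewrite -(fineK fin) sumEFin -EFinM sumr_const -card_draws mulr_natl.
by congr ((_ *+ _)%:E); apply: eq_card => B; rewrite !inE.
Qed.

(** Markov's inequality: the potential is at least 1 before the stop, and its mean decays
    geometrically. *)
Lemma probability_is_stopped_cvg :
  P [set w | is_stopped (Z N w)] @[N --> \oo] --> 1%E.
Proof.
have /andP[e0 e1] := e_bounds; case: idealH => _ _ indepH.
have mS N : measurable [set w | is_stopped (Z N w)].
  exact: (measurable_Z N (fun a => is_stopped a)).
have lower N : 1 - (1 - e / 2) ^+ N * (2 / e)
    <= fine (P [set w | is_stopped (Z N w)]).
  have mC a : measurable [set w | Z N w = a] := measurable_Z N [set a].
  have : fine (P (~` [set w | is_stopped (Z N w)])) <= (1 - e / 2) ^+ N * (2 / e).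
    apply: le_trans (chain_potential (X := hash_vector) indepH measurable_hash_vector
      potential_drift _ N); last by lra.
    have mI a : measurable
        (~` [set w | is_stopped (Z N w)] `&` [set w | Z N w = a]).
      by apply: measurableI => //; exact: measurableC.
    rewrite (measure_finite_partition _ mC (measurableC (mS N))) -sum_fine.
      2: by move=> a _; exact: fin_num_measure.
    apply: ler_sum => a _; case: (boolP (is_stopped a)) => a_stopped.
      rewrite (_ : _ `&` _ = set0) ?measure0 /=.
        rewrite mulr_ge0 ?fine_ge0//.
        case: (a) => [[[? ?] ?]|] /=; first exact: ler0n.
        by rewrite divr_ge0// ltW.
      by apply/seteqP; split=> w //= [/negP + aE]; rewrite aE a_stopped.
    rewrite -[leLHS]mulr1 ler_pM ?fine_ge0//.
      by rewrite fine_le ?fin_num_measure ?le_measure ?inE//; exact: subIsetr.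
    case: a a_stopped => [[[[] ?] ?]|] //= _.
    by rewrite ler_pdivlMr// mul1r; lra.
  rewrite probability_setC// fineB ?fin_num_measure//=; lra.
apply: cvg_EFin; first by apply: nearW => N; exact: fin_num_measure.
apply: (@squeeze_cvgr _ _ _ _ (fun N => 1 - (1 - e / 2) ^+ N * (2 / e)) (fun=> 1)).
- apply: nearW => N; rewrite lower /= -lee_fin fineK ?fin_num_measure//.
  exact: probability_le1.
- rewrite -[X in _ --> X]subr0; apply: cvgB; first exact: cvg_cst.
  rewrite -[X in _ --> X](mul0r (2 / e)); apply: cvgMl.
  by apply: cvg_expr; rewrite ger0_norm; lra.
- exact: cvg_cst.
Qed.

(** Stopped states are absorbing, so the events increase with [N] and continuity from below
    applies. *)
Lemma outcome_cvg (B : set (erased T)) : B `<=` [set a | is_stopped a] ->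
  P [set w | B (Z N w)] @[N --> \oo]
  --> P (\bigcup_N [set w | B (Z N w)]).
Proof.
move=> B_stopped; apply: nondecreasing_cvg_mu => [N||].
- exact: measurable_Z.
- by apply: bigcupT_measurable => N; exact: measurable_Z.
- apply/nondecreasing_seqP => N; apply/subsetPset => w /=.
  move=> Bw; have := B_stopped _ Bw; case: (Z N w) Bw => [[[[] ?] ?]|]//=.
Qed.

Lemma outcome_ae :
  {ae P, forall w, exists q, outcome R c (fun s t => H s t w) q}.
Proof.
have mU : measurable (\bigcup_N [set w | is_stopped (Z N w)]).
  by apply: bigcupT_measurable => N; exact: (measurable_Z N (fun a => is_stopped a)).
exists (~` \bigcup_N [set w | is_stopped (Z N w)]); split.
- exact: measurableC.
- rewrite probability_setC//.
  have <- := cvg_unique (@ereal_hausdorff R) probability_is_stopped_cvg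
    (outcome_cvg (B := [set a | is_stopped a]) (@subset_refl _ _)).
  by rewrite subee.
- move=> w /= running [N _ /=]; rewrite chain_run => /is_stopped_erase[q hq].
  by apply: running; exists q, N.
Qed.

(** At each time [N], stopping with [A] takes a fixed share of the stopping probability, which tends
    to 1. *)
Lemma outcome_uniform (A : {set T}) : #|A| = c ->
  P [set w | exists2 q, outcome R c (fun s t => H s t w) q & ready q = A]
  = (('C(#|T|, c))%:R^-1)%:E.
Proof.
move=> cA; pose B := [set stopped_with A].
have -> : [set w | exists2 q, outcome R c (fun s t => H s t w) q & ready q = A]
    = \bigcup_N [set w | B (Z N w)].
  apply/seteqP; split=> w /=.
    move=> [q [N hN] qA]; exists N => //=; rewrite /B /= chain_run.
    by apply/erase_stopped_with; exists q.
  move=> [N _]; rewrite /B /= chain_run => /erase_stopped_with[q hq qA].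
  by exists q => //; exists N.
have C0 : ('C(#|T|, c)%:R : R) != 0.
  by rewrite pnatr_eq0 -lt0n bin_gt0; case/andP: c_bounds.
have B_stopped : B `<=` [set a | is_stopped a] by move=> _ ->.
have ZB N : P [set w | B (Z N w)]
    = (('C(#|T|, c)%:R^-1)%:E * P [set w | is_stopped (Z N w)])%E.
  by rewrite (probability_is_stopped N cA) muleA -EFinM mulVf// mul1e.
have lim := cvgeZl (isT : (('C(#|T|, c)%:R : R)^-1)%:E \is a fin_num)
  probability_is_stopped_cvg.
rewrite -(funext ZB) in lim.
rewrite -[RHS]mule1.
exact: (cvg_unique (@ereal_hausdorff R) (outcome_cvg B_stopped) lim).
Qed.

End HashedProtocol.

Theorem theorem3p5 (R : realType) (T : finType) (c : nat)
    (d : measure_display) (Omega : measurableType d) (P : probability Omega R)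
    (H : nat -> T -> {RV P >-> nat}) :
  (1 <= c <= #|T|)%N ->
  ideal_hash H ->
  [/\ {ae P, forall w, exists q, outcome R c (fun s t => H s t w) q},
      forall (w : Omega) (q : tags T), outcome R c (fun s t => H s t w) q ->
        [/\ #|ready q| = c,
            {in ready q &, injective (cnt q)}
          & forall k : nat,
              (exists2 t, t \in ready q & cnt q t = k) <-> (1 <= k <= c)%N]
    & forall A : {set T}, #|A| = c ->
        P [set w | exists2 q, outcome R c (fun s t => H s t w) q & ready q = A]
        = (('C(#|T|, c))%:R^-1)%:E].
Proof.
move=> c_bounds idealH; split; first exact: outcome_ae.
- move=> w q [N hN]; have := state_inv_run R c (fun s t => H s t w) N.
  rewrite hN => -[q_inv rq _]; split=> //; first exact: inv_cnt_inj q_inv.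
  move=> k; split=> [[t tr <-]|kc]; first by rewrite -rq (inv_cnt_ready q_inv).
  by apply: counting_inv_onto q_inv _; rewrite rq.
- exact: outcome_uniform.
Qed.
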